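(* Let $n\neq 2$ be a positive integer, let $F_q$ be the finite field with $q$ elements, and let $f$ be a graph automorphism of $\varTheta(M_n(F_q))$. Then there is an invertible matrix $A\in M_n(F_q)$ and an automorphism $\sigma$ of the field $F_q$ such that $f([X])=[AX^{\sigma}A^{-1}]$ for all $X\in M_n(F_q)$.
   Context: For a matrix $X=(x_{ij})_{i,j}$ over $F_q$ and a field automorphism $\sigma$ of $F_q$, $X^\sigma=(\sigma(x_{ij}))_{i,j}$. For a finite unital ring $R$, define $a\sim b$ if and only if $a=bu=vb$ for some units $u,v\in R$; this is an equivalence relation, and $[a]$ denotes the class of $a$. $\varTheta(R)$ is the directed graph whose vertices are the classes $[a]$, $a\in R$, with a directed edge $[x]\to[y]$ ($[x]$, $[y]$ not necessarily distinct) if and only if $xy=0$ (this is well defined). *)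

(* Defs.v *)
From HB Require Import structures.
From mathcomp Require Import all_boot all_order all_algebra.
Set Implicit Arguments.
Unset Strict Implicit.
Unset Printing Implicit Defensive.

Import GRing.Theory.
Local Open Scope ring_scope.
Local Open Scope quotient_scope.

Section Theta.
Variable R : finUnitRingType.

Definition theta_sim (a b : R) : bool :=
  [exists u : R, exists v : R,
    [&& u \is a GRing.unit, v \is a GRing.unit, a == b * u & a == v * b]].

Lemma theta_simP (a b : R) :
  reflect (exists u v : R, [/\ u \is a GRing.unit, v \is a GRing.unit,
                               a = b * u & a = v * b])
          (theta_sim a b).
Proof.
apply: (iffP existsP) => [[u /existsP[v /and4P[uu uv /eqP e1 /eqP e2]]]|].
  by exists u, v.
case=> u [v [uu uv e1 e2]]; exists u; apply/existsP; exists v.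
by rewrite uu uv -e1 -e2 eqxx.
Qed.

Lemma theta_sim_refl : reflexive theta_sim.
Proof.
by move=> a; apply/theta_simP; exists 1, 1; rewrite unitr1 mulr1 mul1r.
Qed.

Lemma theta_sim_sub (a b : R) : theta_sim a b -> theta_sim b a.
Proof.
case/theta_simP=> u [v [uu uv e1 e2]]; apply/theta_simP; exists u^-1, v^-1.
by rewrite !unitrV {1}e1 e2 mulrK // mulKr.
Qed.

Lemma theta_sim_sym : symmetric theta_sim.
Proof. by move=> a b; apply/idP/idP; apply: theta_sim_sub. Qed.

Lemma theta_sim_trans : transitive theta_sim.
Proof.
move=> b a c /theta_simP[u [v [uu uv e1 e2]]] /theta_simP[u' [v' [uu' uv' e3 e4]]].
apply/theta_simP; exists (u' * u), (v * v').
by rewrite !unitrMl // uu' uv mulrA -e3 -e1 -mulrA -e4 -e2.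
Qed.

Canonical theta_equiv :=
  EquivRel theta_sim theta_sim_refl theta_sim_sym theta_sim_trans.

Definition theta_vertex := {eq_quot theta_sim}.

Definition theta_class (a : R) : theta_vertex := \pi a.

(* Stated on representatives; theta_edge_class shows independence of them. *)
Definition theta_edge : rel theta_vertex :=
  fun x y => repr x * repr y == 0.

Lemma theta_classP (a b : R) : theta_class a = theta_class b <-> theta_sim a b.
Proof. by split=> [/eqquotP | ab]; last apply/eqquotP. Qed.

Lemma theta_edge_class (a b : R) :
  theta_edge (theta_class a) (theta_class b) = (a * b == 0).
Proof.
have /theta_classP/theta_simP[_ [v [_ uv _ ea]]] :
  theta_class (repr (theta_class a)) = theta_class a by exact: reprK.
have /theta_classP/theta_simP[u [_ [uu _ eb _]]] :
  theta_class (repr (theta_class b)) = theta_class b by exact: reprK.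
rewrite /theta_edge ea eb -mulrA (mulrA a).
apply/eqP/eqP => [e | ->]; last by rewrite mul0r mulr0.
by apply: (mulrI uv); apply: (mulIr uu); rewrite mulr0 mul0r -e !mulrA.
Qed.

Definition theta_automorphism (f : theta_vertex -> theta_vertex) : Prop :=
  bijective f /\ forall x y, theta_edge (f x) (f y) = theta_edge x y.

End Theta.

(* Main.v *)
(* Since [x] -> [y] means that the row space of x lies in the left kernel of y,
   and every subspace is the row space of one matrix and the left kernel of
   another, comparing neighbourhoods shows that f induces an automorphism of
   the lattice of subspaces of F^(n+1), acting alike on row spaces and on
   kernels.  For n+1 >= 3 this lattice automorphism is semilinear, U |->
   U^sigma B, by the fundamental theorem of projective geometry; a class being
   determined by its row space and its left kernel, f([X]) = [B^-1 X^sigma B].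

   The fundamental theorem is proved in coordinates.  After a change of basis
   the automorphism fixes the points <e_i> and <e_0 + e_i>.  Its action on the
   points of the line through <e_0> and <e_i> is then given by a function
   [slope i] on F, and each field axiom for these functions is the statement
   that a linear form vanishing at the images of two points vanishes at the
   image of every point of the line joining them; additivity uses points such
   as e_0 + (a + b) e_i + e_j, which exist only when n+1 >= 3. *)
From HB Require Import structures.
Require Import Defs.
From mathcomp Require Import all_boot all_order all_algebra.
From mathcomp Require Import ring.
Set Implicit Arguments.
Unset Strict Implicit.
Unset Printing Implicit Defensive.

Import GRing.Theory.
Local Open Scope ring_scope.

(** * Coordinates for a map of points fixing the standard frame *)

Section Coordinatization.

Variables (F : fieldType) (n : nat).

Let e (i : 'I_n.+3) : 'rV[F]_n.+3 := delta_mx 0 i.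

Variable pt : 'rV[F]_n.+3 -> 'rV[F]_n.+3.

Hypothesis pt_eq0 : forall v, (pt v == 0) = (v == 0).
(* The points sent into a hyperplane form a subspace. *)
Hypothesis pt_preim : forall c : 'cV[F]_n.+3,
  exists U : 'M[F]_n.+3, forall v, (pt v *m c == 0) = (v <= U)%MS.
Hypothesis pt_basis : forall i, (pt (e i) <= e i)%MS.
Hypothesis pt_frame : forall i, i != 0 ->
  (pt (e 0 + e i)%R <= (e 0 + e i)%R)%MS.

Let lform (a b c : F) (i j k : 'I_n.+3) (v : 'rV[F]_n.+3) : F :=
  a * v 0 i + b * v 0 j + c * v 0 k.

Let eE i j : e i 0 j = (j == i)%:R.
Proof. by rewrite mxE. Qed.

Lemma lform_preim a b c i j k :
  exists U : 'M[F]_n.+3, forall v,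
    (lform a b c i j k (pt v) == 0) = (v <= U)%MS.
Proof.
have [U HU] := pt_preim (a *: (e i)^T + b *: (e j)^T + c *: (e k)^T).
exists U => v; rewrite -HU /lform.
have eT l (w : 'rV[F]_n.+3) : w *m (e l)^T = (w 0 l)%:M.
  by rewrite /e trmx_delta -colE; apply/rowP=> x; rewrite !mxE !ord1.
rewrite !mulmxDr -!scalemxAr !eT !scale_scalar_mx -!raddfD /=.
rewrite -[X in _ = (X == 0)]scalemx1 scalemx_eq0.
by rewrite (negPf (matrix_nonzero1 _ _)) orbF.
Qed.

Lemma lform_add a b c i j k v w :
  lform a b c i j k (pt v) = 0 -> lform a b c i j k (pt w) = 0 ->
  lform a b c i j k (pt (v + w)) = 0.
Proof.
have [U HU] := lform_preim a b c i j k.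
move=> /eqP; rewrite HU => vU /eqP; rewrite HU => wU; apply/eqP.
by rewrite HU addmx_sub.
Qed.

Lemma lform_scale a b c i j k t v :
  lform a b c i j k (pt v) = 0 -> lform a b c i j k (pt (t *: v)) = 0.
Proof.
have [U HU] := lform_preim a b c i j k.
by move=> /eqP; rewrite HU => vU; apply/eqP; rewrite HU scalemx_sub.
Qed.

Lemma lform_span a b c i j k (v : 'rV_n.+3) :
  (forall l, v 0 l != 0 -> lform a b c i j k (pt (e l)) = 0) ->
  lform a b c i j k (pt v) = 0.
Proof.
have [U HU] := lform_preim a b c i j k.
move=> He; apply/eqP; rewrite HU [v]row_sum_delta.
apply: summx_sub => l _; have [->|nz] := eqVneq (v 0 l) 0.
  by rewrite scale0r sub0mx.
by apply: scalemx_sub; rewrite -HU He.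
Qed.

Lemma pt_basisE i j : i != j -> pt (e i) 0 j = 0.
Proof.
move=> ij; have /sub_rVP[a ->] := pt_basis i.
by rewrite mxE eE eq_sym (negPf ij) mulr0.
Qed.

Lemma pt_basis_neq0 i : pt (e i) 0 i != 0.
Proof.
apply/negP=> /eqP qi; have : pt (e i) == 0.
  apply/eqP/rowP=> j; rewrite [RHS]mxE; have [->//|ji] := eqVneq j i.
  by rewrite pt_basisE // eq_sym.
rewrite pt_eq0 => /eqP/rowP/(_ i); rewrite eE eqxx mxE.
by move/eqP; rewrite oner_eq0.
Qed.

(** The vectors sent into the hyperplane x_k = 0 form a subspace containing every [e l] with
    [l != k]. If it contained a [v] with v_k nonzero, it would contain [e k] as well, against
    [pt_basis_neq0]. *)
Lemma pt_coord_eq0 (v : 'rV_n.+3) k : (pt v 0 k == 0) = (v 0 k == 0).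
Proof.
have lformE (w : 'rV[F]_n.+3) : lform 1 0 0 k k k w = w 0 k.
  by rewrite /lform; ring.
have q0 (w : 'rV_n.+3) : w 0 k = 0 -> pt w 0 k = 0.
  move=> wk; rewrite -lformE; apply: lform_span => l.
  have [->|lk _] := eqVneq l k.
    by rewrite wk eqxx.
  by rewrite lformE pt_basisE.
apply/eqP/eqP => [qk|]; last exact: q0.
apply/eqP; apply: contraTT (pt_basis_neq0 k) => vk; rewrite negbK.
have -> : e k = (v 0 k)^-1 *: v + (e k - (v 0 k)^-1 *: v).
  by rewrite addrC subrK.
rewrite -lformE; apply/eqP; apply: lform_add.
  by apply: lform_scale; rewrite lformE.
by rewrite lformE q0 // !mxE !eqxx mulVf // subrr.
Qed.

(** An affine coordinate, so it depends only on the image point and not on the vector representing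
    it. For [i != 0] the denominator is nonzero by [pt_coord_eq0]. *)
Let slope (i : 'I_n.+3) (a : F) : F :=
  pt (e 0 + a *: e i) 0 i / pt (e 0 + a *: e i) 0 0.

(* [v] is the sum of [p = e 0 + v_i e_i] and of a vector supported off the
   coordinates 0 and i. *)
Lemma pt_affine (v : 'rV_n.+3) i : i != 0 -> v 0 0 = 1 ->
  pt v 0 i = slope i (v 0 i) * pt v 0 0.
Proof.
move=> i0 v0; have i0' : 0 != i by rewrite eq_sym.
move va: (v 0 i) => a; set p := e 0 + a *: e i.
have p0 : pt p 0 0 != 0.
  by rewrite pt_coord_eq0 !mxE !eqxx (negPf i0') mulr0 addr0 oner_eq0.
suff : lform 1 (- slope i a) 0 i 0 0 (pt v) = 0.
  by rewrite /lform => /eqP; rewrite mul1r mul0r addr0 mulNr subr_eq0 => /eqP.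
rewrite -[v](subrK p) addrC; apply: lform_add.
  by rewrite /lform /slope -/p mulNr mulfVK //; ring.
apply: lform_span => l wl.
have l0 : l != 0.
  apply: contraNneq wl => ->.
  by rewrite /p !mxE /= v0 (negPf i0') mulr0 addr0 subrr.
have li : l != i.
  apply: contraNneq wl => ->.
  by rewrite /p !mxE va !eqxx /= (negPf i0) add0r mulr1 subrr.
by rewrite /lform !pt_basisE //; ring.
Qed.

(* [v = (e 0 + v) - e 0], and [pt_affine] applies to [e 0 + v]. *)
Lemma pt_infinite (v : 'rV_n.+3) i j : i != 0 -> j != 0 -> v 0 0 = 0 ->
  pt v 0 i * slope j (v 0 j) = pt v 0 j * slope i (v 0 i).
Proof.
move=> i0 j0 v0.
move vi: (v 0 i) => a; move vj: (v 0 j) => b.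
suff : lform (slope j b) (- slope i a) 0 i j 0 (pt v) = 0.
  rewrite /lform mul0r addr0 mulNr => /eqP; rewrite subr_eq0 => /eqP lv.
  by rewrite mulrC lv mulrC.
have -> : v = (e 0 + v) + (-1) *: e 0 by rewrite scaleN1r addrAC subrr add0r.
set w := e 0 + v.
have w0 : w 0 0 = 1 by rewrite /w mxE v0 addr0 eE eqxx.
have wv l : l != 0 -> w 0 l = v 0 l.
  by move=> l0; rewrite /w mxE eE (negPf l0) add0r.
apply: lform_add; last first.
  apply: lform_scale; rewrite /lform.
  by rewrite (pt_basisE (j := i)) 1?(pt_basisE (j := j)) 1?eq_sym //; ring.
by rewrite /lform (pt_affine i0) // (pt_affine j0) // !wv // vi vj; ring.
Qed.

Lemma slope1 i : i != 0 -> slope i 1 = 1.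
Proof.
move=> i0; have i0' : 0 != i by rewrite eq_sym.
rewrite /slope scale1r; have /sub_rVP[a qE] := pt_frame i0.
have : pt (e 0 + e i) 0 0 != 0.
  by rewrite pt_coord_eq0 mxE !eE eqxx (negPf i0') addr0 oner_eq0.
by rewrite qE !mxE !eqxx /= (negPf i0) (negPf i0') addr0 add0r => /divff.
Qed.

Lemma slopeD i j a b : i != 0 -> j != 0 -> i != j ->
  slope i (a + b) = slope i a + slope i b.
Proof.
(* e 0 + (a + b) e_i + e_j = (e 0 + a e_i) + (b e_i + e_j) *)
move=> i0 j0 ij; have [i0' j0' ji] : [/\ 0 != i, 0 != j & j != i].
  by split; rewrite eq_sym.
set u := e 0 + a *: e i; set v := b *: e i + e j.
have u0 : u 0 0 = 1 by rewrite !mxE /= (negPf i0') mulr0 addr0.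
have ui : u 0 i = a by rewrite !mxE !eqxx /= (negPf i0) add0r mulr1.
have uj : u 0 j = 0.
  by rewrite !mxE /= (negPf ji) (negPf j0) add0r mulr0.
have v0 : v 0 0 = 0.
  by rewrite !mxE /= (negPf i0') (negPf j0') addr0 mulr0.
have vi : v 0 i = b by rewrite !mxE !eqxx /= (negPf ij) mulr1 addr0.
have vj : v 0 j = 1 by rewrite !mxE !eqxx /= (negPf ji) mulr0 add0r.
have wE l : (u + v) 0 l = u 0 l + v 0 l by rewrite mxE.
have w0 : (u + v) 0 0 = 1 by rewrite wE u0 v0 addr0.
have : lform 1 (- slope i a) (- slope i b) i 0 j (pt (u + v)) = 0.
  apply: lform_add.
    have /eqP uj0 : pt u 0 j == 0 by rewrite pt_coord_eq0 uj.
    by rewrite /lform (pt_affine i0) // ui uj0; ring.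
  have /eqP v00 : pt v 0 0 == 0 by rewrite pt_coord_eq0 v0.
  have := pt_infinite i0 j0 v0; rewrite vi vj slope1 // mulr1 => qvi.
  by rewrite /lform v00 qvi; ring.
rewrite /lform (pt_affine i0) // (pt_affine j0) // !wE.
rewrite ui vi uj vj add0r slope1 // => E.
have w00 : pt (u + v) 0 0 != 0 by rewrite pt_coord_eq0 w0 oner_eq0.
apply: (mulIf w00); apply/eqP; rewrite -subr_eq0 -[X in _ == X]E; apply/eqP.
by ring.
Qed.

Lemma slopeM i j a b : i != 0 -> j != 0 -> i != j ->
  slope i (a * b) = slope j a * slope i b.
Proof.
(* e 0 + a b e_i + a e_j lies on the line joining e 0 and b e_i + e_j *)
move=> i0 j0 ij; have [i0' j0' ji] : [/\ 0 != i, 0 != j & j != i].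
  by split; rewrite eq_sym.
set v := b *: e i + e j; set w := e 0 + a *: v.
have v0 : v 0 0 = 0.
  by rewrite !mxE /= (negPf i0') (negPf j0') addr0 mulr0.
have vi : v 0 i = b by rewrite !mxE !eqxx /= (negPf ij) mulr1 addr0.
have vj : v 0 j = 1 by rewrite !mxE !eqxx /= (negPf ji) mulr0 add0r.
have wE l : w 0 l = (l == 0)%:R + a * v 0 l by rewrite mxE eE [X in _ + X]mxE.
have w0 : w 0 0 = 1 by rewrite wE v0 mulr0 addr0.
have : lform 1 (- slope i b) 0 i j 0 (pt w) = 0.
  apply: lform_add.
    by rewrite /lform (pt_basisE i0') (pt_basisE j0'); ring.
  apply: lform_scale; have := pt_infinite i0 j0 v0.
  rewrite vi vj slope1 // mulr1 => qvi.
  by rewrite /lform qvi; ring.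
rewrite /lform (pt_affine i0) // (pt_affine j0) // !wE vi vj.
rewrite (negPf i0) (negPf j0) !add0r mulr1 => E.
have w00 : pt w 0 0 != 0 by rewrite pt_coord_eq0 w0 oner_eq0.
apply: (mulIf w00); apply/eqP; rewrite -subr_eq0 -[X in _ == X]E; apply/eqP.
by ring.
Qed.

(** [slopeD] and [slopeM] require two distinct nonzero indices; this is where dimension at least 3
    enters. *)
Let i1 : 'I_n.+3 := lift 0 0.
Let i2 : 'I_n.+3 := lift 0 (lift 0 0).
Let sigma := slope i1.

(** Since [slope i 1 = 1], the case [b = 1] of [slopeM] identifies the slopes along two axes. *)
Lemma slope_indep i a : i != 0 -> slope i a = sigma a.
Proof.
move=> i0; have [->//|ii1] := eqVneq i i1.
by rewrite -[a in LHS]mulr1 (@slopeM i i1) // slope1 // mulr1.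
Qed.

Lemma slope_nmod_morphism : nmod_morphism sigma.
Proof.
split=> [|a b]; last exact: (@slopeD i1 i2).
by apply: (addrI (sigma 0)); rewrite -(@slopeD i1 i2) // !addr0.
Qed.

Lemma slope_monoid_morphism : monoid_morphism sigma.
Proof.
split=> [|a b]; first exact: slope1.
by rewrite {1}/sigma (@slopeM i1 i2) // slope_indep.
Qed.

Definition coord_morph : {rmorphism F -> F} :=
  HB.pack sigma (GRing.isNmodMorphism.Build F F sigma slope_nmod_morphism)
    (GRing.isMonoidMorphism.Build F F sigma slope_monoid_morphism).

Lemma coord_morphE i a : i != 0 -> coord_morph a = slope i a.
Proof. by move=> i0; rewrite slope_indep. Qed.

(** These are the 2x2 minors of [pt v] and the conjugate of [v]. If v_0 is nonzero, [v] is a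
    multiple of a [w] with w_0 = 1, and a form vanishing at [pt w] vanishes at [pt v]. *)
Lemma pt_proportional (v : 'rV_n.+3) i j :
  pt v 0 i * coord_morph (v 0 j) = pt v 0 j * coord_morph (v 0 i).
Proof.
have [v0|v0] := eqVneq (v 0 0) 0.
  have /eqP qv0 : pt v 0 0 == 0 by rewrite pt_coord_eq0 v0.
  have [->|i0] := eqVneq i 0; first by rewrite qv0 v0 rmorph0 mulr0 mul0r.
  have [->|j0] := eqVneq j 0; first by rewrite qv0 v0 rmorph0 mulr0 mul0r.
  rewrite (coord_morphE (v 0 j) j0) (coord_morphE (v 0 i) i0).
  exact: pt_infinite.
pose w := (v 0 0)^-1 *: v.
have wE l : v 0 l = v 0 0 * w 0 l by rewrite mxE mulVKf.
have w0 : w 0 0 = 1 by rewrite mxE mulVf.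
have qw l : pt w 0 l = coord_morph (w 0 l) * pt w 0 0.
  have [->|l0] := eqVneq l 0; first by rewrite w0 rmorph1 mul1r.
  by rewrite (pt_affine l0) // (coord_morphE _ l0).
move si : (coord_morph (v 0 i)) => a; move sj : (coord_morph (v 0 j)) => b.
suff : lform b (- a) 0 i j 0 (pt v) = 0.
  rewrite /lform mul0r addr0 mulNr => /eqP; rewrite subr_eq0 => /eqP lv.
  by rewrite mulrC lv mulrC.
have -> : v = v 0 0 *: w by rewrite scalerA mulfV // scale1r.
apply: lform_scale; rewrite /lform (qw i) (qw j) -si -sj (wE i) (wE j) !rmorphM.
by ring.
Qed.

Lemma pt_coordinates v : (pt v :=: map_mx coord_morph v)%MS.
Proof.
have [->|v0] := eqVneq v 0.
  by have /eqP-> : pt 0 == 0 by [rewrite pt_eq0]; rewrite map_mx0.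
have /rV0Pn[j vj] := v0.
have sj : coord_morph (v 0 j) != 0 by rewrite fmorph_eq0.
have -> : pt v = (pt v 0 j / coord_morph (v 0 j)) *: map_mx coord_morph v.
  apply/rowP=> i; rewrite !mxE; apply: (mulIf sj).
  by rewrite pt_proportional mulrAC divfK.
by apply: eqmx_scale; rewrite mulf_neq0 ?invr_eq0 ?pt_coord_eq0.
Qed.

End Coordinatization.

(** * Lattice automorphisms: points and frames *)

Section SubspaceLattice.

Variables (F : fieldType) (n : nat) (g : 'M[F]_n.+1 -> 'M[F]_n.+1).

Hypothesis g_mono : forall U V, (g U <= g V)%MS = (U <= V)%MS.
Hypothesis g_surj : forall W : 'M[F]_n.+1, exists U, (g U :=: W)%MS.

Let pt (v : 'rV[F]_n.+1) : 'rV[F]_n.+1 := nz_row (g <<v>>%MS).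

Lemma lattice_iso_eq0 U : (g U == 0) = (U == 0).
Proof.
have [O gO] := g_surj 0.
have O0 : (O <= (0 : 'M[F]_n.+1))%MS by rewrite -g_mono gO sub0mx.
have g0 : g 0 = 0.
  by apply/eqP; rewrite -submx0 -gO g_mono sub0mx.
by rewrite -submx0 -{1}g0 g_mono submx0.
Qed.

Lemma lattice_iso_preim m (W : 'M[F]_(m, n.+1)) :
  exists U : 'M[F]_n.+1, forall V, (g V <= W)%MS = (V <= U)%MS.
Proof.
have [U gU] := g_surj <<W>>%MS.
by exists U => V; rewrite -g_mono gU genmxE.
Qed.

Lemma lattice_pt_eq0 v : (pt v == 0) = (v == 0).
Proof. by rewrite nz_row_eq0 lattice_iso_eq0 -!submx0 genmxE. Qed.

(** Points go to points: the preimage of the span of [pt v] is a nonzero subspace of the line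
    spanned by [v], hence all of it by rank. *)
Lemma lattice_ptE v : (pt v :=: g <<v>>)%MS.
Proof.
have [->|v0] := eqVneq v 0.
  have /eqP g0 : g <<0 : 'rV[F]_n.+1>>%MS == 0.
    by rewrite lattice_iso_eq0 -submx0 genmxE sub0mx.
  have /eqP -> : pt 0 == 0 by rewrite lattice_pt_eq0.
  by rewrite g0; apply/eqmxP; rewrite !sub0mx.
apply/eqmxP; rewrite nz_row_sub /=.
have [U gU] := g_surj <<pt v>>%MS.
have Uv : (U <= <<v>>)%MS by rewrite -g_mono gU genmxE nz_row_sub.
have U0 : U != 0.
  by rewrite -lattice_iso_eq0 -submx0 gU genmxE submx0 lattice_pt_eq0.
suff : (g <<v>> <= <<pt v>>)%MS by rewrite genmxE.
rewrite -gU g_mono -(mxrank_leqif_sup Uv) eqn_leq mxrankS //=.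
by rewrite genmxE rank_rV v0 lt0n mxrank_eq0.
Qed.

Lemma lattice_pt_preim m (W : 'M[F]_(m, n.+1)) :
  exists U : 'M[F]_n.+1, forall v, (pt v <= W)%MS = (v <= U)%MS.
Proof.
have [U HU] := lattice_iso_preim W.
by exists U => v; rewrite lattice_ptE HU genmxE.
Qed.

Lemma lattice_pt_mono v w : (pt v <= pt w)%MS = (v <= w)%MS.
Proof. by rewrite !lattice_ptE g_mono !genmxE. Qed.

Let e (i : 'I_n.+1) : 'rV[F]_n.+1 := delta_mx 0 i.

(** The image lies on the line joining the two image points, and differs from both because [pt]
    reflects inclusion. Giving [pt (e 0)] coefficient 1 lets all the [pt (e i)] be rescaled at once
    in [lattice_frame]. *)
Lemma lattice_pt_unit_point i : i != 0 ->
  exists2 t : F, t != 0 & (pt (e 0 + e i)%R <= (pt (e 0) + t *: pt (e i))%R)%MS.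
Proof.
move=> i0; have i0' : 0 != i by rewrite eq_sym.
have eE k l : e k 0 l = (l == k)%:R by rewrite mxE.
have sumE k : (e 0 + e i) 0 k = (k == 0)%:R + (k == i)%:R by rewrite mxE !eE.
have [U HU] := lattice_pt_preim (col_mx (pt (e 0)) (pt (e i))).
have : (pt (e 0 + e i)%R <= col_mx (pt (e 0)) (pt (e i)))%MS.
  by rewrite HU addmx_sub // -HU -addsmxE ?addsmxSl ?addsmxSr.
rewrite -addsmxE => /sub_addsmxP[[a b] /= E].
rewrite (mx11_scalar a) (mx11_scalar b) !mul_scalar_mx in E.
have a0 : a 0 0 != 0.
  apply/negP=> /eqP a0; have : (pt (e 0 + e i)%R <= pt (e i))%MS.
    by rewrite E a0 scale0r add0r scalemx_sub.
  rewrite lattice_pt_mono => /sub_rVP[t] /rowP/(_ 0) /eqP; rewrite sumE !mxE /=.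
  by rewrite (negPf i0') mulr0 addr0 oner_eq0.
have b0 : b 0 0 != 0.
  apply/negP=> /eqP b0; have : (pt (e 0 + e i)%R <= pt (e 0))%MS.
    by rewrite E b0 scale0r addr0 scalemx_sub.
  rewrite lattice_pt_mono => /sub_rVP[t] /rowP/(_ i) /eqP; rewrite sumE !mxE /=.
  by rewrite eqxx (negPf i0) mulr0 add0r oner_eq0.
exists (b 0 0 / a 0 0); first by rewrite mulf_neq0 ?invr_eq0.
apply/sub_rVP; exists (a 0 0).
by rewrite E scalerDr scalerA mulrCA mulfV // mulr1.
Qed.

Lemma lattice_frame : exists2 B : 'M[F]_n.+1, B \in unitmx &
  (forall i, pt (e i) <= e i *m B)%MS /\
  (forall i, i != 0 -> (pt (e 0 + e i)%R <= (e 0 + e i)%R *m B)%MS).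
Proof.
have /fin_all_exists[t Ht] : forall i, exists t : F, i != 0 ->
    t != 0 /\ (pt (e 0 + e i)%R <= (pt (e 0) + t *: pt (e i))%R)%MS.
  move=> i; have [->|i0] := eqVneq i 0; first by exists 0.
  by have [t t0 tP] := lattice_pt_unit_point i0; exists t.
pose c i := if i == 0 then 1 else t i.
have c0 i : c i != 0.
  by rewrite /c; have [_|/Ht[]] := eqVneq i 0; rewrite ?oner_eq0.
pose B := \matrix_i (c i *: pt (e i)).
have eB i : e i *m B = c i *: pt (e i) by rewrite -rowE rowK.
have qB i : (pt (e i) <= e i *m B)%MS by rewrite eB eqmx_scale.
exists B; last first.
  split=> // i i0; rewrite mulmxDl !eB /c eqxx (negPf i0) scale1r.
  by case: (Ht i i0).
rewrite -row_full_unit -sub1mx.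
have [V gV] := g_surj 1%:M.
have [W HW] := lattice_iso_preim B.
(* [B] has full rank: the largest subspace that [g] sends into its row space contains every [e i],
   so it is everything. *)
suff : (g V <= B)%MS by rewrite gV.
rewrite HW; apply: (submx_trans (submx1 V)); apply/row_subP=> i.
rewrite rowE mulmx1; have := submx_trans (qB i) (submxMl _ _).
by rewrite lattice_ptE HW genmxE.
Qed.

End SubspaceLattice.

Theorem fundamental_theorem_projective_geometry (F : fieldType) (n : nat)
    (g : 'M[F]_n.+3 -> 'M[F]_n.+3) :
  (forall U V, (g U <= g V)%MS = (U <= V)%MS) ->
  (forall W : 'M[F]_n.+3, exists U, (g U :=: W)%MS) ->
  exists2 B : 'M[F]_n.+3, B \in unitmx & exists sigma : {rmorphism F -> F},
    forall U, (g U :=: map_mx sigma U *m B)%MS.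
Proof.
move=> g_mono g_surj; have [B uB [qB qBf]] := lattice_frame g_mono g_surj.
(* Applying the inverse of [B] brings the image frame back to the standard one. *)
pose pt (v : 'rV[F]_n.+3) := nz_row (g <<v>>%MS) *m invmx B.
have ptE v : (pt v *m B :=: g <<v>>)%MS.
  by rewrite mulmxKV //; exact: lattice_ptE.
have q0 v : (pt v == 0) = (v == 0).
  rewrite -(lattice_pt_eq0 g_mono g_surj); apply/eqP/eqP => [E | E].
    by rewrite -[LHS](mulmxKV uB) -/(pt v) E mul0mx.
  by rewrite /pt E mul0mx.
have preim (c : 'cV[F]_n.+3) :
    exists U : 'M[F]_n.+3, forall v, (pt v *m c == 0) = (v <= U)%MS.
  have [U HU] := lattice_pt_preim g_mono g_surj (kermx (invmx B *m c)).
  by exists U => v; rewrite -HU sub_kermx mulmxA.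
have fromB v (w : 'rV_n.+3) :
    (nz_row (g <<v>>) <= w *m B)%MS -> (pt v <= w)%MS.
  by move/(submxMr (invmx B)); rewrite mulmxK.
pose sigma := coord_morph q0 preim (fun i => fromB _ _ (qB i))
  (fun i i0 => fromB _ _ (qBf i i0)).
exists B => //; exists sigma => U.
have gE (v : 'rV[F]_n.+3) : (g <<v>> :=: map_mx sigma v *m B)%MS.
  apply: eqmx_trans (eqmx_sym (ptE v)) _; apply: eqmxMr.
  exact: pt_coordinates.
(* From points to subspaces: both inclusions are checked on the rows of [U]. *)
apply/eqmxP/andP; split.
  have [W HW] := lattice_iso_preim g_mono g_surj (map_mx sigma U *m B).
  rewrite HW; apply/row_subP=> i.
  suff : (<<row i U>> <= W)%MS by rewrite genmxE.
  by rewrite -HW gE map_row -row_mul row_sub.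
apply/row_subP=> i; rewrite row_mul -map_row.
suff : (g <<row i U>> <= g U)%MS by rewrite gE.
by rewrite g_mono genmxE row_sub.
Qed.

(** * From graph automorphisms to lattice automorphisms *)

Section ThetaMatrix.

Variables (F : finFieldType) (n : nat).

Implicit Types X Y W : 'M[F]_n.+1.

(** Equal row spaces give a unit factor on the left. Equal left kernels give equal column spaces,
    hence, by transposition, a unit factor on the right. *)
Lemma theta_class_matrixP X Y :
  theta_class X = theta_class Y <->
  (X == Y)%MS /\ forall W, (W *m X == 0) = (W *m Y == 0).
Proof.
split=> [/theta_classP/theta_simP[u [v [uu uv e1 e2]]] | [eXY kXY]].
  split=> [|W]; first by apply/eqmxMunitP; exists v.
  by rewrite e1 mulmxA mulmx_free_eq0 // row_free_unit.
apply/theta_classP/theta_simP.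
have /eqmxMunitP[v uv e2] := eXY.
have sub (A B : 'M[F]_n.+1) :
    (forall W, (W *m B == 0) -> (W *m A == 0)) -> (A^T <= B^T)%MS.
  move=> kAB; rewrite submxE -trmx_eq0 trmx_mul trmxK kAB //.
  by rewrite -trmx_eq0 trmx_mul trmxK mulmx_coker.
have eT : (X^T == Y^T)%MS.
  by apply/andP; split; apply: sub => W; rewrite kXY.
have /eqmxMunitP[u uu e1] := eT.
exists u^T, v; split=> //; first by rewrite unitmx_tr.
by rewrite -[X]trmxK e1 trmx_mul trmxK.
Qed.

Variable f : theta_vertex 'M[F]_n.+1 -> theta_vertex 'M[F]_n.+1.
Hypothesis hf : theta_automorphism f.

Definition theta_lift X : 'M[F]_n.+1 := repr (f (theta_class X)).

Lemma theta_class_lift X : theta_class (theta_lift X) = f (theta_class X).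
Proof. exact: reprK. Qed.

Lemma theta_lift_mul X Y :
  (theta_lift X *m theta_lift Y == 0) = (X *m Y == 0).
Proof. by have [_ fE] := hf; rewrite -[RHS]theta_edge_class -fE. Qed.

Lemma theta_lift_surj W : exists X, theta_class (theta_lift X) = theta_class W.
Proof.
have [[f' _ fK] _] := hf; exists (repr (f' (theta_class W))).
by rewrite theta_class_lift /theta_class reprK fK.
Qed.

(* The matrices [cokermx Y] realize every subspace as a left kernel, so row
   spaces are ordered by reverse inclusion of right annihilators. *)
Lemma theta_lift_mono X Y :
  (theta_lift X <= theta_lift Y)%MS = (X <= Y)%MS.
Proof.
have mul_sub (A B C : 'M[F]_n.+1) :
    (A <= B)%MS -> B *m C == 0 -> A *m C == 0.
  by move=> /submxP[D ->] /eqP BC; rewrite -mulmxA BC mulmx0.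
apply/idP/idP=> sXY; rewrite submxE.
  rewrite -theta_lift_mul; apply: mul_sub sXY _.
  by rewrite theta_lift_mul mulmx_coker.
have [W] := theta_lift_surj (cokermx (theta_lift Y)).
move=> /theta_class_matrixP[_ kW]; rewrite -kW theta_lift_mul.
by apply: mul_sub sXY _; rewrite -theta_lift_mul kW mulmx_coker.
Qed.

Lemma theta_lift_surj_eqmx W : exists X, (theta_lift X :=: W)%MS.
Proof.
have [X] := theta_lift_surj W.
by move=> /theta_class_matrixP[/eqmxP XW _]; exists X.
Qed.

Lemma theta_automorphism_semilinear (B : 'M[F]_n.+1)
    (sigma : {rmorphism F -> F}) :
  B \in unitmx -> (forall X, theta_lift X :=: map_mx sigma X *m B)%MS ->
  forall X, f (theta_class X) =
            theta_class (invmx B *m map_mx sigma X *m B).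
Proof.
move=> uB liftE X; rewrite -theta_class_lift; apply/theta_class_matrixP.
split=> [|W]; last first.
  (* Whether [W] kills a matrix depends only on its row space, so [W] may be replaced by a lift of
     some [Y], or by Y^sigma B. Both conditions then reduce to Y X = 0. *)
  have [Y YW] := theta_lift_surj_eqmx W.
  rewrite -!sub_kermx -!YW !sub_kermx theta_lift_mul.
  rewrite -sub_kermx liftE sub_kermx !mulmxA mulmxK // -map_mxM.
  by rewrite mulmx_free_eq0 ?row_free_unit // map_mx_eq0.
apply/eqmxP; apply: eqmx_trans (liftE X) _; apply: eqmx_sym.
by rewrite -mulmxA; apply: eqmxMfull; rewrite row_full_unit unitmx_inv.
Qed.

End ThetaMatrix.

Theorem theorem5p1 (n : nat) (hn : n.+1 <> 2%N) (F : finFieldType)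
    (f : theta_vertex 'M[F]_n.+1 -> theta_vertex 'M[F]_n.+1)
    (hf : theta_automorphism f) :
  exists (A : 'M[F]_n.+1) (sigma : {rmorphism F -> F}),
    [/\ A \in unitmx, bijective sigma &
      forall X : 'M[F]_n.+1,
        f (theta_class X) = theta_class (A *m map_mx sigma X *m invmx A)].
Proof.
suff [B uB [sigma liftE]] : exists2 B : 'M[F]_n.+1, B \in unitmx &
    exists sigma : {rmorphism F -> F},
      forall X, (theta_lift f X :=: map_mx sigma X *m B)%MS.
  exists (invmx B), sigma; split; first by rewrite unitmx_inv.
    exact: injF_bij (fmorph_inj sigma).
  by move=> X; rewrite invmxK; exact: theta_automorphism_semilinear.
have g_mono := theta_lift_mono hf; have g_surj := theta_lift_surj_eqmx hf.
case: n hn f hf g_mono g_surj => [|[//|n]] _ f hf g_mono g_surj.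
  (* In dimension 1 the only subspaces are 0 and the whole space, and [theta_lift f] preserves
     each. *)
  exists 1%:M; rewrite ?unitmx1 //; exists idfun => X.
  rewrite mulmx1 map_mx_id //; have := lattice_iso_eq0 g_mono g_surj X.
  have full (Z : 'M[F]_1) : Z != 0 -> (Z :=: 1%:M)%MS.
    move=> Z0; apply/eqmxP; rewrite submx1 sub1mx /row_full eqn_leq.
    by rewrite rank_leq_col lt0n mxrank_eq0.
  have [-> /eqP-> //|X0 gX0] := eqVneq X 0.
  by apply: eqmx_trans (eqmx_sym (full _ X0)); apply: full; rewrite gX0.
exact: fundamental_theorem_projective_geometry.
Qed.
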